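(* Algorithm WS-MULT (described in the context) is a set-linearizable, wait-free, fence-free algorithm for (FIFO) work-stealing with multiplicity that uses atomic Read/Write objects and a single atomic MaxRegister object. Moreover, all of its operations (Put, Take, Steal) have constant step complexity, and Put uses only Read/Write instructions.
   Context: Model: $n\ge 2$ asynchronous processes $p_0,\dots,p_{n-1}$ that may crash, communicating through atomic base objects; each atomic operation on a base object is one step. Process $p_0$ is the owner (it invokes Put and Take); every other process is a thief (it invokes Steal). An execution is a sequence of steps, invocations and responses of high-level operations in which each process invokes a new operation only after the previous one has responded. For complete operations, ${\sf op}<_E{\sf op}'$ iff the response of op precedes the invocation of op' in execution $E$; operations incomparable under $<_E$ are concurrent. An operation is wait-free if every invocation by a process that keeps taking steps completes in a finite number of its own steps. The step complexity of an operation is the maximum number of steps a process needs to complete it. An algorithm or operation is fence-free if it does not require any specific ordering among its steps beyond what is implied by data dependence. In the pseudocode, $\{I_1,\dots,I_x\}$ denotes instructions that may be executed in any order. A set-sequential specification is a state machine whose transition function $\delta$ takes a state and a set (concurrency class) of invocations and returns a new state and a set of responses. A finite execution $E$ is set-linearizable if there is a set-sequential execution $S$ of the specification such that: $S$ contains every completed operation of $E$ and possibly some pending ones, with inputs and outputs agreeing with $E$; and whenever ${\sf op}<_E{\sf op}'$, the class of op appears before the class of op' in $S$. An algorithm is set-linearizable if all its finite executions are. (FIFO) work-stealing with multiplicity, as a set-sequential specification. Tasks are drawn from $\mathbb N=\{1,2,\dots\}$. States are finite strings over $\mathbb N$, with initial state the empty string $\epsilon$; the first symbol is the head. Transitions: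 (1) $\delta(q,{\sf Put}(x))=(q\cdot x,\langle{\sf Put}(x):{\sf true}\rangle)$. (2) For $0\le t\le n-1$: $\delta(x\cdot q,\{{\sf Take}(),{\sf Steal}_1(),\dots,{\sf Steal}_t()\})=(q,\{\langle{\sf Take}():x\rangle,\langle{\sf Steal}_1():x\rangle,\dots,\langle{\sf Steal}_t():x\rangle\})$. (3) For $1\le t\le n-1$: $\delta(x\cdot q,\{{\sf Steal}_1(),\dots,{\sf Steal}_t()\})=(q,\{\langle{\sf Steal}_j():x\rangle\}_j)$. (4) $\delta(\epsilon,{\sf Take}())=(\epsilon,\langle{\sf Take}():{\sf empty}\rangle)$. (5) $\delta(\epsilon,{\sf Steal}())=(\epsilon,\langle{\sf Steal}():{\sf empty}\rangle)$. A MaxRegister object provides two operations: MaxRead, which returns the largest value written so far (or the initial value), and MaxWrite$(v)$, which writes $v$ only if $v$ exceeds the current maximum. Algorithm WS-MULT. Shared objects: - $Head$, an atomic MaxRegister initialized to $1$. - $Tasks[1,2,\dots]$, an array of atomic Read/Write objects with $Tasks[1]$ and $Tasks[2]$ initialized to $\bot$. The owner has a persistent local variable $tail\leftarrow 0$. Put$(x)$: $tail\leftarrow tail+1$; $\{Tasks[tail].{\sf Write}(x),\ Tasks[tail+2].{\sf Write}(\bot)\}$; return true. Take$()$: $head\leftarrow Head.{\sf MaxRead}()$; if $head\le tail$ then $\{x\leftarrow Tasks[head].{\sf Read}(),\ Head.{\sf MaxWrite}(head+1)\}$ and return $x$; otherwise return empty. Steal$()$: $head\leftarrow Head.{\sf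 MaxRead}()$; $x\leftarrow Tasks[head].{\sf Read}()$; if $x\ne\bot$ then $Head.{\sf MaxWrite}(head+1)$ and return $x$; otherwise return empty. *)

(* Defs.v *)
From HB Require Import structures.
From Stdlib Require List.
From mathcomp Require Import all_boot.

Set Implicit Arguments.
Unset Strict Implicit.
Unset Printing Implicit Defensive.

(* High-level operations and responses.  Tasks are positive naturals;       *)
(* the value 0 encodes bottom (⊥).                                           *)

Definition BOT : nat := 0.

Inductive op : Type := Put of nat | Take | Steal.

Inductive resp : Type := RTrue | RVal of nat | REmpty.

Definition resp_eqb (r1 r2 : resp) : bool :=
  match r1, r2 with
  | RTrue, RTrue => true
  | RVal x, RVal y => x == y
  | REmpty, REmpty => true
  | _, _ => false
  end.

Lemma resp_eqP : Equality.axiom resp_eqb.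
Proof.
case=> [|x|] [|y|] /=; try by constructor.
by apply: (iffP eqP) => [->|[]].
Qed.

HB.instance Definition _ := hasDecEq.Build resp resp_eqP.

Definition is_take (o : op) : bool := if o is Take then true else false.
Definition is_steal (o : op) : bool := if o is Steal then true else false.

(* Base objects: Head (atomic MaxRegister) and Tasks[1,2,...] (atomic       *)
(* Read/Write registers).  Every primitive below is ONE step.               *)

Inductive prim : Type :=
| PMaxRead
| PMaxWrite of nat
| PRead of nat
| PWrite of nat & nat.

Definition is_rw (p : prim) : bool :=
  match p with PRead _ | PWrite _ _ => true | _ => false end.

(* Local control state of a process (program counter + local variables).
   Braced instruction pairs {I1, I2} are modelled by two completion flags;
   at each step the process nondeterministically (via a boolean) chooses
   which of the still pending instructions to execute (fence-freedom). *)
Inductive lstate : Type :=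
| Idle
| PutSt of nat & nat & bool & bool
    (* tail, x, Tasks[tail].Write(x) done?, Tasks[tail+2].Write(⊥) done? *)
| TakeInit
| TakeSt of nat & option nat & bool
    (* head, result of Tasks[head].Read() (if done), MaxWrite done?       *)
| StealInit
| StealTask of nat                          (* head; about to read Tasks   *)
| StealWrite of nat & nat                   (* head, x; about to MaxWrite  *)
| Done of resp.

Definition next_prim (s : lstate) (b : bool) : option prim :=
  match s with
  | PutSt t x wA wB =>
      match wA, wB with
      | false, false => Some (if b then PWrite t x else PWrite t.+2 BOT)
      | false, true => Some (PWrite t x)
      | true, false => Some (PWrite t.+2 BOT)
      | true, true => None
      end
  | TakeInit => Some PMaxRead
  | TakeSt h rx mw =>
      match rx, mw with
      | None, false => Some (if b then PRead h else PMaxWrite h.+1)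
      | None, true => Some (PRead h)
      | Some _, false => Some (PMaxWrite h.+1)
      | Some _, true => None
      end
  | StealInit => Some PMaxRead
  | StealTask h => Some (PRead h)
  | StealWrite h _ => Some (PMaxWrite h.+1)
  | _ => None
  end.

(* New local state after the step chosen by b returned value v;
   tail is the owner's persistent local variable. *)
Definition after (s : lstate) (b : bool) (v : nat) (tail : nat) : lstate :=
  match s with
  | PutSt t x wA wB =>
      match wA, wB with
      | false, false => if b then PutSt t x true false else PutSt t x false true
      | _, _ => Done RTrue
      end
  | TakeInit => if v <= tail then TakeSt v None false else Done REmpty
  | TakeSt h rx mw =>
      match rx, mw with
      | None, false => if b then TakeSt h (Some v) false else TakeSt h None true
      | None, true => Done (RVal v)
      | Some x, false => Done (RVal x)
      | Some _, true => s
      end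
  | StealInit => StealTask v
  | StealTask h => if v != BOT then StealWrite h v else Done REmpty
  | StealWrite _ x => Done (RVal x)
  | _ => s
  end.

(* Global configuration: shared memory, the owner's local tail, and the
   local states of all processes (process ids are naturals < n; p_0 = owner). *)
Record config : Type := Config {
  c_head  : nat;
  c_tasks : nat -> nat;
  c_tail  : nat;
  c_loc   : nat -> lstate }.

Definition upd_loc (c : config) (p : nat) (s : lstate) : config :=
  Config (c_head c) (c_tasks c) (c_tail c)
         (fun q => if q == p then s else c_loc c q).

Definition exec_prim (c : config) (pr : prim) : config * nat :=
  match pr with
  | PMaxRead => (c, c_head c)
  | PMaxWrite v => (Config (maxn (c_head c) v) (c_tasks c) (c_tail c) (c_loc c), 0)
  | PRead i => (c, c_tasks c i)
  | PWrite i v =>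
      (Config (c_head c) (fun j => if j == i then v else c_tasks c j)
              (c_tail c) (c_loc c), 0)
  end.

Inductive event : Type :=
| Inv of nat & op
| Step of nat & bool
| Resp of nat & resp.

Definition is_idle (s : lstate) : bool := if s is Idle then true else false.

Definition apply_event (n : nat) (c : config) (e : event) : option config :=
  match e with
  | Inv p o =>
      if (p < n) && is_idle (c_loc c p) then
        match o with
        | Put x =>
            if (p == 0) && (0 < x) then
              Some (upd_loc (Config (c_head c) (c_tasks c) (c_tail c).+1 (c_loc c))
                            p (PutSt (c_tail c).+1 x false false))
            else None
        | Take => if p == 0 then Some (upd_loc c p TakeInit) else None
        | Steal => if p != 0 then Some (upd_loc c p StealInit) else None
        end
      else None
  | Step p b =>
      if p < n then
        match next_prim (c_loc c p) b with
        | Some pr =>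
            let (c', v) := exec_prim c pr in
            Some (upd_loc c' p (after (c_loc c p) b v (c_tail c)))
        | None => None
        end
      else None
  | Resp p r =>
      if p < n then
        match c_loc c p with
        | Done r' => if r == r' then Some (upd_loc c p Idle) else None
        | _ => None
        end
      else None
  end.

Definition run (n : nat) (c : config) (E : seq event) : option config :=
  foldl (fun oc e => obind (fun c => apply_event n c e) oc) (Some c) E.

(* Initial configuration: Head = 1, Tasks[1] = Tasks[2] = ⊥ (other cells
   arbitrary, given by init), tail = 0, all processes idle. *)
Definition init_cfg (init : nat -> nat) : config :=
  Config 1 init 0 (fun _ => Idle).

(* Operations of an execution (identified by the index of their invocation) *)

Definition inv_at (E : seq event) (i : nat) : option (nat * op) :=
  match nth (Step 0 false) E i with
  | Inv p o => Some (p, o)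
  | _ => None
  end.

Definition op_of (E : seq event) (i : nat) : op :=
  if inv_at E i is Some (_, o) then o else Take.

Fixpoint first_resp (p : nat) (s : seq event) (k : nat) : option (nat * resp) :=
  match s with
  | [::] => None
  | e :: s' =>
      match e with
      | Resp q r => if q == p then Some (k, r) else first_resp p s' k.+1
      | _ => first_resp p s' k.+1
      end
  end.

Definition complete_at (E : seq event) (i : nat) : option (nat * resp) :=
  match inv_at E i with
  | Some (p, _) => first_resp p (drop i.+1 E) i.+1
  | None => None
  end.

Definition precedes (E : seq event) (i j : nat) : Prop :=
  inv_at E j <> None /\ exists k r, complete_at E i = Some (k, r) /\ k < j.

(* A concurrency class is given as a duplicate-free list of (op, response). *)

Definition ws_delta (n : nat) (q : seq nat) (cls : seq (op * resp)) (q' : seq nat) : Prop :=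
  (exists x, cls = [:: (Put x, RTrue)] /\ q' = rcons q x)
  \/ (exists x, q = x :: q'
        /\ (forall pr, List.In pr cls -> (pr.1 = Take \/ pr.1 = Steal) /\ pr.2 = RVal x)
        /\ count is_take (map fst cls) = 1
        /\ count is_steal (map fst cls) <= n.-1)
  \/ (exists x, q = x :: q'
        /\ (forall pr, List.In pr cls -> pr.1 = Steal /\ pr.2 = RVal x)
        /\ 1 <= size cls <= n.-1)
  \/ (q = [::] /\ q' = [::] /\ cls = [:: (Take, REmpty)])
  \/ (q = [::] /\ q' = [::] /\ cls = [:: (Steal, REmpty)]).

Fixpoint ws_run (n : nat) (q : seq nat) (S : seq (seq (op * resp))) : Prop :=
  match S with
  | [::] => True
  | c :: S' => exists q', ws_delta n q c q' /\ ws_run n q' S'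
  end.

(* A set-sequential execution S (list of concurrency classes, each a list of
   (operation id, response)) set-linearizes E. *)
Definition set_linearizable (n : nat) (E : seq event) : Prop :=
  exists S : seq (seq (nat * resp)),
    (forall c ir, List.In c S -> List.In ir c -> inv_at E ir.1 <> None)
    /\ uniq [seq ir.1 | ir <- flatten S]
    /\ (forall i k r, complete_at E i = Some (k, r) ->
          exists c, List.In c S /\ List.In (i, r) c)
    /\ ws_run n [::] [seq [seq (op_of E ir.1, ir.2) | ir <- c] | c <- S]
    /\ (forall k1 k2 i j r1 r2,
          List.In (i, r1) (nth [::] S k1) -> List.In (j, r2) (nth [::] S k2) ->
          precedes E i j -> k1 < k2).

Fixpoint before_resp (p : nat) (s : seq event) : seq event :=
  match s with
  | [::] => [::]
  | e :: s' =>
      match e with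
      | Resp q _ => if q == p then [::] else e :: before_resp p s'
      | _ => e :: before_resp p s'
      end
  end.

Definition is_step_of (p : nat) (e : event) : bool :=
  if e is Step q _ then q == p else false.

Definition op_steps (E : seq event) (i : nat) : nat :=
  match inv_at E i with
  | Some (p, _) => count (is_step_of p) (before_resp p (drop i.+1 E))
  | None => 0
  end.

Definition reachable (n : nat) (init : nat -> nat) (c : config) : Prop :=
  exists E, run n (init_cfg init) E = Some c.

(* Main.v *)
Require Import Defs.
From mathcomp Require Import all_boot.
From mathcomp Require Import zify.

(* A forward simulation in which the abstract queue holds the tasks from index
   Head up to the last one written.  A cell that is readable (index at most
   Head, hence at most one past the last written task) holds bottom or its
   final task.  Every operation returning task h has read Head = h and, before
   responding, makes sure that Head > h; so it spans the unique step moving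
   Head from h to h+1.  At that step all processes that have read h, of which
   at most one is the owner, are linearized together as one class removing the
   head of the queue.  A Put is linearized when it writes its task, an empty
   Take when it reads Head, and an empty Steal when it reads bottom, at which
   moment Head is still the value it has read. *)

Set Implicit Arguments.
Unset Strict Implicit.
Unset Printing Implicit Defensive.

(** * Executions and their histories *)

Lemma run_rcons n c E e :
  run n c (rcons E e) = obind (fun c' => apply_event n c' e) (run n c E).
Proof. by rewrite /run foldl_rcons. Qed.

Lemma run_cat n c E1 E2 :
  run n c (E1 ++ E2) = obind (fun c' => run n c' E2) (run n c E1).
Proof.
elim/last_ind: E2 => [|E2 e IH]; first by rewrite cats0; case: (run n c E1).
by rewrite -rcons_cat !run_rcons IH; case: (run n c E1) => //= c'; rewrite run_rcons.
Qed.

Lemma run_cons n c e E :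
  run n c (e :: E) = obind (fun c' => run n c' E) (apply_event n c e).
Proof. by rewrite -cat1s run_cat. Qed.

Lemma In_mem (T : eqType) (x : T) (s : seq T) : List.In x s <-> x \in s.
Proof.
elim: s => [|y s IH] //=; rewrite inE; split.
  by case=> [->|/IH ->]; rewrite ?eqxx ?orbT.
by case/orP=> [/eqP->|/IH]; [left|right].
Qed.

Lemma In_map (T U : Type) (f : T -> U) (y : U) (s : seq T) :
  List.In y (map f s) -> exists2 x, List.In x s & y = f x.
Proof.
elim: s => [|x s IH] //= [<-|/IH [z zs ->]]; first by exists x => //; left.
by exists z => //; right.
Qed.

Lemma inv_at_rcons E e i :
  inv_at (rcons E e) i =
  if i == size E then (if e is Inv p o then Some (p, o) else None)
  else inv_at E i.
Proof.
rewrite /inv_at nth_rcons; case: ltngtP => // H.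
by rewrite nth_default // ltnW.
Qed.

Lemma inv_at_size E i : inv_at E i <> None -> i < size E.
Proof. by case: (ltnP i (size E)) => // H []; rewrite /inv_at nth_default. Qed.

Lemma first_resp_rcons p s e k :
  first_resp p (rcons s e) k =
  if first_resp p s k is Some kr then Some kr
  else if e is Resp q r then if q == p then Some (k + size s, r) else None
  else None.
Proof.
elim: s k => [|a s IH] k /=; first by rewrite addn0; case: e.
by case: a => [q o|q b|q r]; rewrite IH addSnnS //; case: ifP.
Qed.

Lemma complete_at_rcons E e i :
  complete_at (rcons E e) i =
  if complete_at E i is Some kr then Some kr
  else match inv_at E i, e with
       | Some (p, _), Resp q r => if q == p then Some (size E, r) else None
       | _, _ => None
       end.
Proof.
rewrite /complete_at inv_at_rcons.
case: (ltngtP i (size E)) => Hi.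
- case: (inv_at E i) => [[p o]|] //.
  rewrite drop_rcons // first_resp_rcons size_drop.
  by rewrite subnKC.
- have -> : inv_at E i = None by rewrite /inv_at nth_default // ltnW.
  by [].
- subst i; have -> : inv_at E (size E) = None by rewrite /inv_at nth_default.
  by case: e => // p o; rewrite drop_oversize ?size_rcons.
Qed.

Lemma inv_at_Step E p b i : inv_at (rcons E (Step p b)) i = inv_at E i.
Proof.
by rewrite inv_at_rcons; case: eqP => // ->; rewrite /inv_at nth_default.
Qed.

Lemma complete_at_Step E p b i :
  complete_at (rcons E (Step p b)) i = complete_at E i.
Proof.
by rewrite complete_at_rcons; case: complete_at => //; case: inv_at => // -[].
Qed.

Lemma complete_at_Inv E p o i :
  complete_at (rcons E (Inv p o)) i = complete_at E i.
Proof.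
by rewrite complete_at_rcons; case: complete_at => //; case: inv_at => // -[].
Qed.

(** * Histories: candidate set-linearizations of an execution *)

Definition ids (S : seq (seq (nat * resp))) : seq nat :=
  [seq ir.1 | ir <- flatten S].

Definition labels (E : seq event) (S : seq (seq (nat * resp))) :=
  [seq [seq (op_of E ir.1, ir.2) | ir <- c] | c <- S].

Lemma ids_rcons S c : ids (rcons S c) = ids S ++ [seq ir.1 | ir <- c].
Proof. by rewrite /ids flatten_rcons map_cat. Qed.

Lemma mem_nth_flatten {T : eqType} (S : seq (seq T)) k x :
  x \in nth [::] S k -> x \in flatten S.
Proof.
move=> H; apply/flattenP; exists (nth [::] S k) => //; apply: mem_nth.
by rewrite ltnNge; apply/negP => Hk; rewrite nth_default in H.
Qed.

(** The requirements of [set_linearizable] other than legality for the specification, which is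
    tracked apart together with the queue that is reached. *)
Record hist (E : seq event) (S : seq (seq (nat * resp))) : Prop := Hist {
  hist_inv : forall i, i \in ids S -> inv_at E i <> None;
  hist_uniq : uniq (ids S);
  hist_complete : forall i k r,
    complete_at E i = Some (k, r) -> (i, r) \in flatten S;
  hist_prec : forall k1 k2 i j r1 r2,
    (i, r1) \in nth [::] S k1 -> (j, r2) \in nth [::] S k2 ->
    precedes E i j -> k1 < k2 }.

Lemma mem_ids_nth S k i r : (i, r) \in nth [::] S k -> i \in ids S.
Proof. by move=> /mem_nth_flatten H; apply/mapP; exists (i, r). Qed.

Lemma hist_Step E S p b : hist E S -> hist (rcons E (Step p b)) S.
Proof.
case=> H1 H2 H3 H4; split=> //.
- by move=> i; rewrite inv_at_Step; apply: H1.
- by move=> i k r; rewrite complete_at_Step; apply: H3.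
- move=> k1 k2 i j r1 r2 i1 i2; rewrite /precedes inv_at_Step complete_at_Step.
  exact: H4 i1 i2.
Qed.

Lemma hist_Inv E S p o : hist E S -> hist (rcons E (Inv p o)) S.
Proof.
case=> H1 H2 H3 H4; split=> //.
- by move=> i /H1; rewrite inv_at_rcons; case: eqP.
- by move=> i k r; rewrite complete_at_Inv; apply: H3.
- move=> k1 k2 i j r1 r2 i1 i2; rewrite /precedes complete_at_Inv => -[_ Hk].
  by apply: (H4 _ _ _ _ _ _ i1 i2); split=> //; apply: H1; apply: mem_ids_nth i2.
Qed.

(** The new response has index [size E], beyond every invocation, so it creates no precedence pair;
    the hypothesis covers the pending operation that it completes. *)
Lemma hist_Resp E S p r :
  (forall i o, inv_at E i = Some (p, o) -> complete_at E i = None ->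
     (i, r) \in flatten S) ->
  hist E S -> hist (rcons E (Resp p r)) S.
Proof.
move=> Hp [H1 H2 H3 H4]; split=> //.
- move=> i /H1; rewrite inv_at_rcons; case: eqP => // -> [].
  by rewrite /inv_at nth_default.
- move=> i k r'; rewrite complete_at_rcons.
  case E1: complete_at => [[k1 r1]|]; first by case=> _ <-; apply: H3 E1.
  case E2: inv_at => [[q o]|] //; case: eqP => // pq [_ <-].
  by apply: Hp E1; rewrite E2 pq.
- move=> k1 k2 i j r1 r2 i1 i2 [_ [k [r' [Hk kj]]]].
  have Hj : inv_at E j <> None by apply: H1; apply: mem_ids_nth i2.
  apply: (H4 _ _ _ _ _ _ i1 i2); split=> //; exists k, r'; split=> //.
  move: Hk; rewrite complete_at_rcons; case: complete_at => // .
  case: inv_at => [[q o]|] //; case: eqP => // pq [Ek _].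
  by move/inv_at_size: Hj; rewrite ltnNge Ek ltnW.
Qed.

(* A class whose operations are all pending may be appended: an operation that
   precedes one of them is complete, hence already in an earlier class. *)
Lemma hist_rcons E S cls :
  hist E S -> uniq [seq ir.1 | ir <- cls] ->
  (forall ir, ir \in cls -> [/\ ir.1 \notin ids S, inv_at E ir.1 <> None &
     complete_at E ir.1 = None]) ->
  hist E (rcons S cls).
Proof.
move=> [H1 H2 H3 H4] Hu Hcls; split=> //.
- move=> i; rewrite ids_rcons mem_cat => /orP[/H1//|/mapP[ir /Hcls[_ ? _] ->]//].
- rewrite ids_rcons cat_uniq H2 Hu andbT /=; apply/hasPn => i /mapP[ir /Hcls[H _ _] ->].
  exact: H.
- by move=> i k r /H3 H; rewrite flatten_rcons mem_cat H.
- move=> k1 k2 i j r1 r2; rewrite !nth_rcons => i1 i2 Hp.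
  have Hik : (i, r1) \notin cls.
    apply/negP => /Hcls [_ _]; case: Hp => _ [k [r [-> _]]] //.
  move: i1; case: ltnP => // Hk1; last by case: ifP => //; rewrite (negPf Hik).
  move=> i1; move: i2; case: ltnP => Hk2; last by move=> _; apply: leq_trans Hk1 Hk2.
  by move=> i2; apply: H4 i1 i2 Hp.
Qed.

(** [ws_run] with its final state exposed, so that runs can be extended at the end and the final
    state compared with [queue c]. *)
Fixpoint ws_path n (q : seq nat) (L : seq (seq (op * resp))) (q' : seq nat) : Prop :=
  if L is cls :: L' then exists2 q1, ws_delta n q cls q1 & ws_path n q1 L' q'
  else q = q'.

Lemma ws_path_run n q L q' : ws_path n q L q' -> ws_run n q L.
Proof. by elim: L q => //= cls L IH q [q1 H /IH]; exists q1. Qed.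

Lemma ws_path_rcons n q L q1 cls q' :
  ws_path n q L q1 -> ws_delta n q1 cls q' -> ws_path n q (rcons L cls) q'.
Proof.
elim: L q => /= [q -> H|c L IH q [q2 H2 HL] H]; first by exists q'.
by exists q2 => //; apply: IH.
Qed.

Lemma op_of_rcons E e i : inv_at E i <> None -> op_of (rcons E e) i = op_of E i.
Proof.
by move=> /inv_at_size H; rewrite /op_of inv_at_rcons; case: eqP => // Hi; lia.
Qed.

Lemma labels_rcons E e S :
  (forall i, i \in ids S -> inv_at E i <> None) ->
  labels (rcons E e) S = labels E S.
Proof.
move=> H; apply/eq_in_map => c cS; apply/eq_in_map => ir irc.
rewrite op_of_rcons //; apply: H; apply: map_f; apply/flattenP; by exists c.
Qed.

(** * Configurations *)

(* Number of tasks present in the array: a pending Put counts once its write of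
   [Tasks[tail]] is done. *)
Definition written (c : config) : nat :=
  if c_loc c 0 is PutSt _ _ false _ then (c_tail c).-1 else c_tail c.

Definition queue (c : config) : seq nat :=
  [seq c_tasks c i | i <- iota (c_head c) ((written c).+1 - c_head c)].

(* The response of an operation in local state [s], if already linearized:
   having read [h] from Head, it joins the class removing task [h] at the very
   step that moves Head past [h]. *)
Definition lin (c : config) (s : lstate) : option resp :=
  match s with
  | PutSt _ _ true _ => Some RTrue
  | TakeSt h _ _ | StealTask h | StealWrite h _ =>
      if h < c_head c then Some (RVal (c_tasks c h)) else None
  | Done r => Some r
  | _ => None
  end.

(** The clauses [~~ (wA && wB)] and [~~ mw] exclude states with both flags set: the second
    instruction of a braced pair leads directly to [Done]. Only [StealTask] allows [h] to be one
    past the last written task, as the thief has not yet tested the cell. *)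
Definition loc_ok (c : config) (p : nat) (s : lstate) : Prop :=
  match s with
  | Idle | Done _ => True
  | PutSt t x wA wB =>
      [/\ p = 0, t = c_tail c, 0 < t, 0 < x & ~~ (wA && wB)]
  | TakeInit => p = 0
  | TakeSt h rx mw =>
      [/\ p = 0, 0 < h <= written c, h <= c_head c, mw -> h < c_head c
        & if rx is Some x then x = c_tasks c h /\ ~~ mw else True]
  | StealInit => p <> 0
  | StealTask h => p <> 0 /\ 0 < h <= c_head c
  | StealWrite h x =>
      [/\ p <> 0, 0 < h <= written c, h <= c_head c & x = c_tasks c h]
  end.

(* Cells beyond [tail + 1] may hold garbage while a Put is in progress. *)
Definition bot_ok (c : config) : Prop :=
  match c_loc c 0 with
  | PutSt _ _ wA wB =>
      [/\ ~~ wA -> c_tasks c (c_tail c) = BOT, c_tasks c (c_tail c).+1 = BOT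
        & wB -> c_tasks c (c_tail c).+2 = BOT]
  | _ => c_tasks c (c_tail c).+1 = BOT /\ c_tasks c (c_tail c).+2 = BOT
  end.

(** By [ok_head] the queue is empty exactly when [c_head c = (written c).+1]. *)
Record cfg_ok (n : nat) (c : config) : Prop := CfgOk {
  ok_idle : forall p, n <= p -> c_loc c p = Idle;
  ok_head : 0 < c_head c <= (written c).+1;
  ok_tasks : forall i, 0 < i <= written c -> 0 < c_tasks c i;
  ok_bot : bot_ok c;
  ok_loc : forall p, loc_ok c p (c_loc c p) }.

(** This cell is [Tasks[tail]] while a Put has not written its task, and [Tasks[tail+1]] otherwise.
    It is what a thief reads when it has reached the end of the queue. *)
Lemma ok_last n c : cfg_ok n c -> c_tasks c (written c).+1 = BOT.
Proof.
case=> _ _ _ + /(_ 0); rewrite /bot_ok /written.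
case: (c_loc c 0) => [|t x [] wB||h rx mw||h|h x|r] //; try by case.
by move=> [/(_ isT) H _ _] /= [_ Et t0 _ _]; rewrite prednK -?Et // Et.
Qed.

(** Non-interference: what a process knows survives the moves of the others. The tail is compared
    for the owner only, because invoking a Put increments it and the clauses of thieves do not
    mention it. *)
Lemma loc_ok_mono c c' p s :
  c_head c <= c_head c' -> written c <= written c' ->
  (p = 0 -> c_tail c = c_tail c') ->
  (forall i, 0 < i <= written c -> c_tasks c' i = c_tasks c i) ->
  loc_ok c p s -> loc_ok c' p s.
Proof.
move=> Hh Hw Ht Hi; case: s => [|t x wA wB||h rx mw||h|h x|r] //=.
- by case=> p0; rewrite Ht.
- case=> -> H0 H1 H2 H3; split=> //; try lia.
  case: rx H3 => // x [-> Hm]; split=> //; by rewrite Hi.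
- by case=> ? ?; split=> //; lia.
- case=> ? H0 H1 ->; split=> //; try lia. by rewrite Hi.
Qed.

(** A linearized [h] is below [Head], hence at most [written c], where cells are frozen; so the
    response is fixed at linearization, even for a Take that has not read its task. *)
Lemma lin_mono n c c' p s r :
  cfg_ok n c -> loc_ok c p s -> c_head c <= c_head c' ->
  (forall i, 0 < i <= written c -> c_tasks c' i = c_tasks c i) ->
  lin c s = Some r -> lin c' s = Some r.
Proof.
move=> /ok_head /andP[_ Hw] Hs Hh Ht.
have H h : 0 < h -> (if h < c_head c then Some (RVal (c_tasks c h)) else None) = Some r ->
    (if h < c_head c' then Some (RVal (c_tasks c' h)) else None) = Some r.
  by move=> h0; case: ltnP => // hh <-; rewrite ifT ?Ht //; lia.
case: s Hs => //=.
- by move=> h rx mw [_ /andP[h0 _] _ _ _]; apply: H.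
- by move=> h [_ /andP[h0 _]]; apply: H.
- by move=> h x [_ /andP[h0 _] _ _]; apply: H.
Qed.

Lemma lin_same_head n c c' p s :
  cfg_ok n c -> loc_ok c p s -> c_head c' = c_head c ->
  (forall i, 0 < i <= written c -> c_tasks c' i = c_tasks c i) ->
  lin c' s = lin c s.
Proof.
move=> Hok Hs Hh Ht; case E: (lin c s) => [r|].
  by apply: lin_mono Hok Hs _ Ht E; rewrite Hh.
by case: s E {Hs} => [|t x wA wB||h rx mw||h|h x|r] //=; rewrite Hh; case: ifP.
Qed.

(** * The class linearized by one step *)

Definition op_of_loc (s : lstate) : op :=
  match s with
  | PutSt _ x _ _ => Put x
  | StealInit | StealTask _ | StealWrite _ _ => Steal
  | _ => Take
  end.

Definition newly_lin (n : nat) (c c' : config) : seq nat :=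
  [seq q <- iota 0 n |
    ~~ isSome (lin c (c_loc c q)) && isSome (lin c' (c_loc c' q))].

Definition queue_step (n : nat) (c c' : config) : Prop :=
  (newly_lin n c c' = [::] /\ queue c' = queue c) \/
  ws_delta n (queue c)
    [seq (op_of_loc (c_loc c q), odflt REmpty (lin c' (c_loc c' q)))
       | q <- newly_lin n c c'] (queue c').

(** [step_op] exempts [Done], which no longer records its operation and for which [op_of_loc]
    returns a dummy [Take]. *)
Record step_ok (n : nat) (c c' : config) : Prop := StepOk {
  step_cfg : cfg_ok n c';
  step_busy : forall q, is_idle (c_loc c' q) = is_idle (c_loc c q);
  step_op : forall q, (exists r, c_loc c' q = Done r) \/
                      op_of_loc (c_loc c' q) = op_of_loc (c_loc c q);
  step_lin : forall q r,
    lin c (c_loc c q) = Some r -> lin c' (c_loc c' q) = Some r;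
  step_queue : queue_step n c c' }.

Record mem_mono (c c' : config) : Prop := MemMono {
  mono_head : c_head c <= c_head c';
  mono_written : written c <= written c';
  mono_tail : c_tail c = c_tail c';
  mono_tasks : forall i, 0 < i <= written c -> c_tasks c' i = c_tasks c i }.

(** Monotonicity of the memory settles all processes but [p]; what remains concerns the new memory,
    the new state of [p] and the queue. *)
Lemma step_okI n c c1 p s' :
  let c' := upd_loc c1 p s' in
  cfg_ok n c -> c_loc c1 = c_loc c ->
  ~~ is_idle (c_loc c p) -> ~~ is_idle s' ->
  (exists r, s' = Done r) \/ op_of_loc s' = op_of_loc (c_loc c p) ->
  mem_mono c c' ->
  c_head c' <= (written c').+1 ->
  (forall i, written c < i <= written c' -> 0 < c_tasks c' i) ->
  bot_ok c' -> loc_ok c' p s' ->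
  (forall r, lin c (c_loc c p) = Some r -> lin c' s' = Some r) ->
  queue_step n c c' -> step_ok n c c'.
Proof.
move=> c' Hok El Hb Hb' Hop Hm Hh Ht Hbot Hloc Hlin Hq.
have Lp : c_loc c' p = s' by rewrite /= eqxx.
have Lq q : q != p -> c_loc c' q = c_loc c q by rewrite /= El => /negPf ->.
split=> //.
- split=> //.
  + move=> q nq; case: (q =P p) => [qp|/eqP/Lq ->]; last exact: ok_idle Hok q nq.
    by move: Hb; rewrite -qp (ok_idle Hok nq).
  + rewrite Hh andbT; case/andP: (ok_head Hok) => H _; exact: leq_trans (mono_head Hm).
  + move=> i /andP[i0 iw]; case: (leqP i (written c)) => iw'.
      by rewrite (mono_tasks Hm) ?i0 // (ok_tasks Hok) // i0.
    by apply: Ht; rewrite iw' iw.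
  + move=> q; case: (q =P p) => [->|/eqP/Lq ->]; first by rewrite Lp.
    by case: Hm => *; apply: (@loc_ok_mono c) => //; apply: ok_loc Hok q.
- move=> q; case: (q =P p) => [->|/eqP/Lq -> //].
  by rewrite Lp (negPf Hb) (negPf Hb').
- by move=> q; case: (q =P p) => [->|/eqP/Lq ->]; [rewrite Lp|right].
- move=> q r; case: (q =P p) => [->|/eqP/Lq ->]; first by rewrite Lp; apply: Hlin.
  by apply: lin_mono Hok (ok_loc Hok q) (mono_head Hm) (mono_tasks Hm).
Qed.

(** The other processes keep their local state, and their status can change only through a move of
    [Head]. *)
Lemma newly_lin_same_head n c c1 p s' :
  let c' := upd_loc c1 p s' in
  cfg_ok n c -> p < n -> c_loc c1 = c_loc c -> c_head c' = c_head c ->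
  (forall i, 0 < i <= written c -> c_tasks c' i = c_tasks c i) ->
  newly_lin n c c' =
  if ~~ isSome (lin c (c_loc c p)) && isSome (lin c' s') then [:: p] else [::].
Proof.
move=> c' Hok pn El Hh Ht; rewrite /newly_lin.
set b := (_ && _).
transitivity [seq q <- iota 0 n | b && (q == p)].
  apply: eq_in_filter => q _; rewrite /b /= El.
  case: eqP => [->|_]; first by rewrite andbT.
  rewrite (lin_same_head Hok (ok_loc Hok q) Hh Ht) andbF; by case: (lin c _).
case: b; last by elim: (iota 0 n).
by rewrite filter_pred1_uniq ?iota_uniq // mem_iota.
Qed.

Lemma queue_same c c' :
  c_head c' = c_head c -> written c' = written c -> 0 < c_head c ->
  (forall i, 0 < i <= written c -> c_tasks c' i = c_tasks c i) ->
  queue c' = queue c.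
Proof.
move=> Hh Hw H0 Ht; rewrite /queue Hh Hw; apply/eq_in_map => i.
by rewrite mem_iota => H; apply: Ht; lia.
Qed.

(** * Steps *)

Lemma count_steal_procs n (s : seq nat) :
  0 < n -> uniq s -> {subset s <= iota 0 n} -> count (predC1 0) s <= n.-1.
Proof.
move=> n0 Us sub; rewrite -size_filter.
have : {subset [seq q <- s | predC1 0 q] <= iota 1 n.-1}.
  move=> q; rewrite mem_filter mem_iota /= => /andP[q0 /sub]; rewrite mem_iota.
  lia.
by move=> /(uniq_leq_size (filter_uniq _ Us)); rewrite size_iota.
Qed.

(** If process 0 is in [s] this is a removal with one Take, otherwise a removal by thieves alone; at
    most [n.-1] members are thieves. *)
Lemma delta_remove n (x : nat) (q s : seq nat) (o : nat -> op)
    (r : nat -> resp) :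
  0 < n -> uniq s -> {subset s <= iota 0 n} -> s != [::] ->
  (forall p, p \in s -> o p = (if p == 0 then Take else Steal) /\ r p = RVal x) ->
  ws_delta n (x :: q) [seq (o p, r p) | p <- s] q.
Proof.
move=> n0 Us sub s0 Hs.
have Ht : count is_take (map fst [seq (o p, r p) | p <- s]) = count (pred1 0) s.
  rewrite -map_comp count_map; apply: eq_in_count => p /Hs [/= -> _].
  by case: (p == 0).
have Hl : count is_steal (map fst [seq (o p, r p) | p <- s]) = count (predC1 0) s.
  rewrite -map_comp count_map; apply: eq_in_count => p /Hs [/= -> _].
  by case: (p == 0).
have Hc := count_steal_procs n0 Us sub.
have Hall pr : List.In pr [seq (o p, r p) | p <- s] ->
    exists2 p, p \in s & pr = (o p, r p).
  by move=> H; have [p /In_mem ps ->] := In_map H; exists p.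
case: (boolP (0 \in s)) => s00.
  right; left; exists x; split=> //; rewrite Ht Hl count_uniq_mem // s00; split=> //.
  move=> pr H; case: (Hall pr H) => p ps -> /=; case: (Hs p ps) => -> ->; split=> //.
  by case: ifP; [left|right].
right; right; left; exists x; split=> //; split.
  move=> pr H; case: (Hall pr H) => p ps -> /=; case: (Hs p ps) => -> ->; split=> //.
  by case: eqP => // p0; rewrite -p0 ps in s00.
rewrite size_map lt0n size_eq0 s0 /=.
suff -> : size s = count (predC1 0) s by [].
symmetry; apply/eqP; rewrite -all_count; apply/allP => p ps.
by apply/eqP => /= p0; rewrite -p0 ps in s00.
Qed.

Section Steps.
Variables (n : nat) (c : config).
Hypothesis Hok : cfg_ok n c.

(** The linearization point of Put: [written] grows from [t.-1] to [t]. *)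
Lemma step_put_write t x wB :
  0 < n -> c_loc c 0 = PutSt t x false wB ->
  step_ok n c (upd_loc (exec_prim c (PWrite t x)).1 0
                 (if wB then Done RTrue else PutSt t x true false)).
Proof.
move=> n0 L0; set s' := if wB then _ else _.
have := ok_loc Hok 0; rewrite L0 /= => -[_ tE t0 x0 _].
have := ok_bot Hok; rewrite /bot_ok L0 => -[_ B1 B2].
have Wc : written c = t.-1 by rewrite /written L0 tE.
set c' := upd_loc _ _ _.
have Wc' : written c' = t by rewrite /written /= /s'; case: (wB).
have Ht : forall i, 0 < i <= written c -> c_tasks c' i = c_tasks c i.
  by move=> i; rewrite Wc /= => Hi; case: eqP => // ?; lia.
have Hh := ok_head Hok; rewrite Wc in Hh.
apply: step_okI => //; rewrite ?L0 -/c' ?Wc' //.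
- by rewrite ?/c' /s' /=; case: (wB).
- by rewrite /s'; case: (wB); [left; exists RTrue|right].
- by split=> //; rewrite Wc Wc'; lia.
- by rewrite /=; lia.
- move=> i Hi /=; have -> : i = t by lia.
  by rewrite eqxx.
- rewrite /bot_ok /c' /= /s' -tE; case: wB L0 B2 {s' c' Wc' Ht} => L0 B2.
    by rewrite !ifF ?tE ?B1 ?B2 //; apply/eqP; lia.
  by split=> //; rewrite ifF ?tE //; apply/eqP; lia.
- by rewrite ?/c' /s' /=; case: (wB).
- have Hl : lin c' s' = Some RTrue by rewrite /s'; case: (wB).
  rewrite /queue_step; have -> : newly_lin n c c' = [:: 0].
    by rewrite newly_lin_same_head // L0 -/c' Hl.
  right; left; exists x; split.
    by rewrite /map L0 (_ : c_loc c' 0 = s') // Hl.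
  rewrite /queue Wc' Wc -cats1 prednK //=.
  (* [c_head c <= t] since [Head] exceeds [written c = t.-1] by at most one; hence the index range
     gains exactly [t], at its end. *)
  rewrite subSn; last by lia.
  rewrite -addn1 iotaD map_cat /= subnKC ?eqxx; last by lia.
  congr (_ ++ _); apply/eq_in_map => i; rewrite mem_iota => Hi.
  by rewrite ifF //; apply/eqP; lia.
Qed.

Lemma queue_step_same p s' c1 :
  let c' := upd_loc c1 p s' in
  p < n -> c_loc c1 = c_loc c -> c_head c' = c_head c -> written c' = written c ->
  (forall i, 0 < i <= written c -> c_tasks c' i = c_tasks c i) ->
  lin c' s' = lin c (c_loc c p) -> queue_step n c c'.
Proof.
move=> c' pn El Hh Hw Ht Hl; left; split.
  by rewrite newly_lin_same_head // Hl; case: (lin c _).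
by case/andP: (ok_head Hok) => h0 _; apply: queue_same.
Qed.

(** Cell [t.+2] lies beyond all written tasks, so the queue is untouched; if this write finishes the
    Put, its task was written and linearized before. *)
Lemma step_put_bot t x wA :
  0 < n -> c_loc c 0 = PutSt t x wA false ->
  step_ok n c (upd_loc (exec_prim c (PWrite t.+2 BOT)).1 0
                 (if wA then Done RTrue else PutSt t x false true)).
Proof.
move=> n0 L0; set s' := if wA then _ else _.
have := ok_loc Hok 0; rewrite L0 /= => -[_ tE t0 x0 _].
have := ok_bot Hok; rewrite /bot_ok L0 => -[B0 B1 _].
have Wt : written c <= t by rewrite /written L0 tE; case: (wA); lia.
set c' := upd_loc _ _ _.
have Wc' : written c' = written c by rewrite /written /= L0 /s'; case: (wA).
have Ht : forall i, 0 < i <= written c -> c_tasks c' i = c_tasks c i.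
  by move=> i /= Hi; case: eqP => // ?; lia.
case/andP: (ok_head Hok) => Hh0 Hh.
have Hl : lin c' s' = lin c (c_loc c 0).
  by rewrite L0 /s'; case: (wA).
apply: step_okI => //; rewrite ?L0 -/c' ?Wc' //.
- by rewrite ?/c' /s' /=; case: (wA).
- by rewrite /s'; case: (wA); [left; exists RTrue|right].
- by split=> //; rewrite Wc'.
- by move=> i; lia.
- have T0 : c_tasks c t = BOT -> c_tasks c' t = BOT by rewrite /=; case: eqP.
  have T1 : c_tasks c' t.+1 = BOT by rewrite /= tE B1; case: eqP.
  have T2 : c_tasks c' t.+2 = BOT by rewrite /= eqxx.
  rewrite /bot_ok (_ : c_loc c' 0 = s') // (_ : c_tail c' = t) //.
  rewrite -tE in B0.
  by rewrite /s'; case: (wA) B0 => B0; split=> // H; apply: T0; apply: B0.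
- by rewrite ?/c' /s' /=; case: (wA).
- by move=> r <-; rewrite -/s' Hl L0.
- exact: queue_step_same.
Qed.

Lemma written_upd c1 p s :
  c_loc c1 = c_loc c -> c_tail c1 = c_tail c ->
  (forall t x wA wB, c_loc c p <> PutSt t x wA wB) ->
  (forall t x wA wB, s <> PutSt t x wA wB) ->
  written (upd_loc c1 p s) = written c.
Proof.
move=> El Et Hp Hs; rewrite /written /= El Et.
case: eqP => // p0; rewrite p0.
case: s Hs => [|t x wA wB||h rx mw||h|h x|r] Hs;
  case: (c_loc c p) Hp => [|t' x' wA' wB'||h' rx' mw'||h'|h' x'|r'] Hp //;
  try by case: (Hs t x wA wB).
all: by case: (Hp t' x' wA' wB').
Qed.

Lemma bot_ok_upd c1 p s :
  c_loc c1 = c_loc c -> c_tail c1 = c_tail c -> c_tasks c1 = c_tasks c ->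
  (forall t x wA wB, c_loc c p <> PutSt t x wA wB) ->
  (forall t x wA wB, s <> PutSt t x wA wB) ->
  bot_ok (upd_loc c1 p s).
Proof.
move=> El Et Es Hp Hs; have := ok_bot Hok; rewrite /bot_ok /= El Et Es.
case: eqP => // p0; rewrite p0.
case: s Hs => [|t x wA wB||h rx mw||h|h x|r] Hs;
  case: (c_loc c p) Hp => [|t' x' wA' wB'||h' rx' mw'||h'|h' x'|r'] Hp //;
  try by case: (Hs t x wA wB).
all: by case: (Hp t' x' wA' wB').
Qed.

(** Covers all steps that leave shared memory unchanged, [PMaxRead] included. The second alternative
    is the linearization point of an operation answering empty. *)
Lemma step_read p s' :
  p < n ->
  (forall t x wA wB, c_loc c p <> PutSt t x wA wB) ->
  (forall t x wA wB, s' <> PutSt t x wA wB) ->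
  ~~ is_idle (c_loc c p) -> ~~ is_idle s' ->
  (exists r, s' = Done r) \/ op_of_loc s' = op_of_loc (c_loc c p) ->
  loc_ok c p s' ->
  lin c s' = lin c (c_loc c p) \/
  [/\ c_head c = (written c).+1, lin c (c_loc c p) = None, s' = Done REmpty
    & op_of_loc (c_loc c p) = Take \/ op_of_loc (c_loc c p) = Steal] ->
  step_ok n c (upd_loc c p s').
Proof.
move=> pn Hp Hs' Hb Hb' Hop Hl Hlin.
have Hw : written (upd_loc c p s') = written c by apply: written_upd.
case/andP: (ok_head Hok) => Hh0 Hh.
apply: step_okI => //; rewrite ?Hw //.
- by split=> //; rewrite Hw.
- by move=> i; lia.
- exact: bot_ok_upd.
- by apply: loc_ok_mono Hl => //; rewrite Hw.
- move=> r; case: Hlin => [<- <-|[_ -> _ _]] //.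
- case: Hlin => [Hlin|[Hhe Hn Es Ho]].
    by apply: queue_step_same => //; rewrite -Hlin; case: (s').
  have Q : queue c = [::] by rewrite /queue Hhe subnn.
  have Q' : queue (upd_loc c p s') = [::] by rewrite /queue Hw /= Hhe subnn.
  have L' : c_loc (upd_loc c p s') p = Done REmpty by rewrite /= eqxx.
  rewrite /queue_step Q Q'.
  have -> : newly_lin n c (upd_loc c p s') = [:: p].
    by rewrite newly_lin_same_head // Hn Es.
  right; rewrite /map L' /=.
  by right; right; right; case: Ho => ->; [left|right].
Qed.

Definition local_head (s : lstate) : option nat :=
  match s with
  | TakeSt h _ _ | StealTask h | StealWrite h _ => Some h
  | _ => None
  end.

(** If [Head] is already past [h], then [p] was linearized earlier and the write has no effect.
    Otherwise [Head] moves from [h] to [h.+1] and removes task [h]. *)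
Lemma step_maxwrite p h s' :
  p < n -> local_head (c_loc c p) = Some h -> 0 < h <= written c -> h <= c_head c ->
  (s' = Done (RVal (c_tasks c h)) \/
   [/\ s' = TakeSt h None true & op_of_loc (c_loc c p) = Take]) ->
  step_ok n c (upd_loc (exec_prim c (PMaxWrite h.+1)).1 p s').
Proof.
move=> pn Hlh /andP[h0 hw] hh Hs'.
have Hp t x wA wB : c_loc c p <> PutSt t x wA wB by move=> E; rewrite E in Hlh.
have Hs t x wA wB : s' <> PutSt t x wA wB by case: Hs' => [->|[-> _]].
set c' := upd_loc _ _ _.
have Hw : written c' = written c by apply: written_upd.
case/andP: (ok_head Hok) => Hh0 Hh.
have hh' : h < c_head c' by rewrite /=; lia.
have Hl' : lin c' s' = Some (RVal (c_tasks c h)).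
  by case: Hs' => [->|[-> _]] //; rewrite /lin hh'.
have Hlc : lin c (c_loc c p) =
    if h < c_head c then Some (RVal (c_tasks c h)) else None.
  by case: (c_loc c p) Hlh => //= [h1 rx mw|h1|h1 x] [->].
have Hop : op_of_loc (c_loc c p) = if p == 0 then Take else Steal.
  have := ok_loc Hok p; case: (c_loc c p) Hlh => //= [h1 rx mw|h1|h1 x] _.
  - by case=> ->.
  - by case=> /eqP/negPf ->.
  - by case=> /eqP/negPf ->.
apply: step_okI => //; rewrite -/c' ?Hw //.
- by case: (c_loc c p) Hlh.
- by case: Hs' => [->|[-> _]].
- by case: Hs' => [->|[-> ->]]; [left; exists (RVal (c_tasks c h))|right].
- by split=> //; rewrite ?Hw //=; lia.
- by rewrite /=; lia.
- by move=> i; lia.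
- exact: bot_ok_upd.
- case: Hs' => [->//|[-> Ho]] /=; split=> //; rewrite ?Hw; try lia.
  by move: Hop; rewrite Ho; case: eqP.
- by move=> r; rewrite Hlc Hl'; case: ifP.
- case: (ltnP h (c_head c)) => hc.
    by apply: queue_step_same => //=; [lia|rewrite -/c' Hl' Hlc hc].
  have Eh : c_head c = h by lia.
  have Eh' : c_head c' = h.+1 by rewrite /= Eh; lia.
  rewrite /queue_step; have -> : queue c = c_tasks c h :: queue c'.
    by rewrite /queue Hw Eh Eh' subSS subSn.
  right.
  (* A newly linearized [q] holds some [h1] with [c_head c <= h1 < h.+1], which forces [h1 = h]. *)
  have Hin q : q \in newly_lin n c c' ->
      op_of_loc (c_loc c q) = (if q == 0 then Take else Steal) /\
      odflt REmpty (lin c' (c_loc c' q)) = RVal (c_tasks c h).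
    rewrite mem_filter => /andP[+ _]; rewrite /c' /= -/c'.
    case: (q =P p) => [-> _|_]; first by rewrite Hl'.
    have := ok_loc Hok q; case: (c_loc c q) => //=.
    + by move=> t x [].
    + move=> h1 rx mw [-> _ h1h _ _]; rewrite -/(c_head c') -/c'.
      case: ltnP => //= h1c; case: ltnP => //= h1c' _.
      by have -> : h1 = h by lia.
    + move=> h1 [/eqP/negPf -> _]; case: ltnP => //= h1c; case: ltnP => //= h1c' _.
      by have -> : h1 = h by lia.
    + move=> h1 x [/eqP/negPf -> _ _ _]; case: ltnP => //= h1c; case: ltnP => //= h1c' _.
      by have -> : h1 = h by lia.
  apply: delta_remove Hin; first by lia.
  + by rewrite filter_uniq // iota_uniq.
  + by move=> q; rewrite mem_filter => /andP[].
  (* The class is nonempty because it contains the writer [p] itself. *)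
  + apply/eqP => E0; have : p \in newly_lin n c c'.
      rewrite mem_filter mem_iota /= pn Hlc ltnNge hc /= eqxx.
      by rewrite -/c' Hl'.
    by rewrite E0.
Qed.

Lemma step_correct p b c' :
  apply_event n c (Step p b) = Some c' -> step_ok n c c'.
Proof.
rewrite /apply_event; case: ifP => // pn.
have := ok_loc Hok p; case/andP: (ok_head Hok) => Hh0 Hh.
case E: (c_loc c p) => [|t x wA wB||h rx mw||h|h x|r] //=.
- case=> p0 tE t0 x0; subst p.
  case: wA E => E; case: wB E => // E _; last case: b.
  + rewrite /exec_prim => /Some_inj <-; exact: step_put_bot pn E.
  + rewrite /exec_prim => /Some_inj <-; exact: step_put_write pn E.
  + rewrite /exec_prim => /Some_inj <-; exact: step_put_write pn E.
  + rewrite /exec_prim => /Some_inj <-; exact: step_put_bot pn E.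
- move=> p0; subst p; move=> /Some_inj <-.
  (* The owner is in a Take, so no Put is in progress and the test against the tail compares [Head]
     with the last written task. *)
  have W : written c = c_tail c by rewrite /written E.
  case: ifP => Hc; apply: step_read; rewrite ?E //=.
  + by right.
  + by rewrite W Hc Hh0; split.
  + by left; rewrite ltnn.
  + by left; exists REmpty.
  + by right; split=> //; [lia|left].
- case=> p0 hw hh Hmw Hrx; subst p.
  (* [b'] tells whether the read finishes the Take. In that case the [PMaxWrite] is done, so [h] is
     below [Head] and the Take is already linearized. *)
  have Hread (b' : bool) : (b' -> mw) ->
     step_ok n c (upd_loc c 0
       (if b' then Done (RVal (c_tasks c h))
        else TakeSt h (Some (c_tasks c h)) false)).
    move=> b'mw; apply: step_read => //; try by case: b' {b'mw}; rewrite ?E.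
    + by case: b' {b'mw}; [left; exists (RVal (c_tasks c h))|right; rewrite E].
    + left; rewrite E; case: b' b'mw => //= /(_ isT)/Hmw -> //.
  have Hwrite s' : (s' = Done (RVal (c_tasks c h)) \/ s' = TakeSt h None true) ->
     step_ok n c (upd_loc (exec_prim c (PMaxWrite h.+1)).1 0 s').
    move=> Hs'; apply: step_maxwrite => //; rewrite ?E //.
    by case: Hs' => ->; [left|right].
  case: rx Hrx E => [x [-> nm]|_] E.
    by rewrite (negPf nm) /exec_prim => /Some_inj <-; apply: Hwrite; left.
  case: mw E Hmw Hread => E Hmw Hread.
  + by rewrite /exec_prim => /Some_inj <-; apply: (Hread true).
  + case: b; rewrite /exec_prim => /Some_inj <-; first exact: (Hread false).
    by apply: Hwrite; right.
- move=> p0 /Some_inj <-; apply: step_read; rewrite ?E //=; first by right.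
  + by split=> //; rewrite Hh0 leqnn.
  + by left; rewrite ltnn.
- case=> p0 /andP[h0 hh] /Some_inj <-.
  (* Since [h] is at most [(written c).+1], the only readable cell that is not written is the one
     shown to be bottom by [ok_last]. *)
  have hx : c_tasks c h != BOT -> h <= written c.
    move=> /eqP H; rewrite leqNgt; apply/negP => hw; apply: H.
    have -> : h = (written c).+1 by lia.
    exact: ok_last Hok.
  case: ifP => Hx; apply: step_read; rewrite ?E //=.
  + by right.
  + by split=> //; rewrite h0 hx.
  + by left.
  + by left; exists REmpty.
  (* Written cells are positive, so reading bottom gives [written c < h <= c_head c <= (written
     c).+1]: [Head] still equals [h] and the queue is empty. *)
  + right; split=> //; last by right.
      have : ~~ (h <= written c).
        apply/negP => hw; have := ok_tasks Hok (i := h); rewrite h0 hw.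
        by move=> /(_ isT); move/negbFE/eqP: Hx => ->.
      by lia.
    case: ltnP => // hc; have := ok_tasks Hok (i := h).
    have -> : 0 < h <= written c by lia.
    by move=> /(_ isT); move/negbFE/eqP: Hx => ->.
- case=> p0 hw hh -> /Some_inj <-; apply: step_maxwrite => //; rewrite ?E //.
  by left.
Qed.

End Steps.

(** * Simulation and step complexity *)

Lemma cfg_ok_upd n c p s :
  cfg_ok n c -> p < n ->
  (forall t x wA wB, c_loc c p <> PutSt t x wA wB) ->
  (forall t x wA wB, s <> PutSt t x wA wB) ->
  loc_ok c p s ->
  cfg_ok n (upd_loc c p s) /\ queue (upd_loc c p s) = queue c.
Proof.
move=> Hok pn Hp Hs Hl.
have Hw : written (upd_loc c p s) = written c by apply: written_upd.
split; last by rewrite /queue Hw.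
split; rewrite ?Hw; try by case: Hok.
- move=> q nq /=; case: eqP => [qp|_]; last by case: Hok => + _ _ _ _; apply.
  by move: pn; rewrite -qp ltnNge nq.
- exact: (bot_ok_upd Hok (c1 := c)).
- move=> q /=; case: eqP => [->|_]; apply: (@loc_ok_mono c) => //; rewrite ?Hw //.
  by case: Hok.
Qed.

(** [written] discounts the unwritten task, so incrementing the tail does not change it. The two
    bottom cells after the old tail become [Tasks[tail]] and [Tasks[tail+1]], as [bot_ok] demands of
    a Put. *)
Lemma cfg_ok_put n c x :
  let c' := upd_loc (Config (c_head c) (c_tasks c) (c_tail c).+1 (c_loc c))
              0 (PutSt (c_tail c).+1 x false false) in
  cfg_ok n c -> 0 < n -> c_loc c 0 = Idle -> 0 < x ->
  cfg_ok n c' /\ queue c' = queue c.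
Proof.
move=> c' Hok n0 L0 x0.
have Hw : written c' = written c by rewrite /written L0.
split; last by rewrite /queue Hw.
split; rewrite ?Hw; try by case: Hok.
- move=> q nq /=; case: eqP => [q0|_]; last by case: Hok => + _ _ _ _; apply.
  by move: n0; rewrite -q0 ltnNge nq.
- by have := ok_bot Hok; rewrite /bot_ok L0 => -[B1 B2].
- move=> q; rewrite /c' /= -/c'; case: eqP => [->|q0]; first by split.
  by apply: (@loc_ok_mono c) => //; rewrite ?Hw //; case: Hok.
Qed.

(** [id p] is the index of the current invocation of [p], arbitrary when [p] is idle. The last
    clause of [linked_busy] makes [S] contain exactly those current operations that are linearized,
    with their final responses. *)
Record linked (E : seq event) (c : config) (S : seq (seq (nat * resp)))
    (id : nat -> nat) : Prop := Linked {
  linked_busy : forall p, ~~ is_idle (c_loc c p) -> exists o,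
    [/\ inv_at E (id p) = Some (p, o), complete_at E (id p) = None,
        (exists r, c_loc c p = Done r) \/ op_of_loc (c_loc c p) = o
      & is_true (if lin c (c_loc c p) is Some r then (id p, r) \in flatten S
                 else id p \notin ids S)];
  linked_pending : forall i p o, inv_at E i = Some (p, o) ->
    complete_at E i = None -> ~~ is_idle (c_loc c p) /\ i = id p }.

Definition simulates n E c : Prop := exists S id,
  [/\ hist E S, ws_path n [::] (labels E S) (queue c), cfg_ok n c
    & linked E c S id].

Lemma simulates_init n init :
  init 1 = BOT -> init 2 = BOT -> simulates n [::] (init_cfg init).
Proof.
move=> i1 i2; exists [::], id; split.
- split=> // [i k r|k1 k2 i j r1 r2]; last by rewrite nth_nil.
  by rewrite /complete_at /inv_at nth_nil.
- by [].
- by split=> // i; rewrite /written /=; lia.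
- by split=> // i p o; rewrite /inv_at nth_nil.
Qed.

Lemma linked_Step E c c' S S' id p b :
  linked E c S id ->
  (forall q, is_idle (c_loc c' q) = is_idle (c_loc c q)) ->
  (forall q, (exists r, c_loc c' q = Done r) \/
             op_of_loc (c_loc c' q) = op_of_loc (c_loc c q)) ->
  (forall r q, c_loc c q = Done r -> c_loc c' q = Done r) ->
  (forall q, ~~ is_idle (c_loc c q) ->
     is_true (if lin c' (c_loc c' q) is Some r then (id q, r) \in flatten S'
              else id q \notin ids S')) ->
  linked (rcons E (Step p b)) c' S' id.
Proof.
move=> [H1 H2] Hb Ho Hd HS'; split.
- move=> q Hq; rewrite Hb in Hq; case: (H1 q Hq) => o [I C O L].
  exists o; rewrite inv_at_Step complete_at_Step; split=> //; last exact (HS' q Hq).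
  case: O => [[r /Hd Er]|<-]; last exact: Ho.
  by left; exists r.
- by move=> i q o; rewrite inv_at_Step complete_at_Step Hb; apply: H2.
Qed.

Lemma simulates_Step n E c p b c' :
  simulates n E c -> apply_event n c (Step p b) = Some c' ->
  simulates n (rcons E (Step p b)) c'.
Proof.
move=> [S [id [HH HP Hok HL]]] Ha.
case: (step_correct Hok Ha) => Hok' Hb Ho Hlin Hq.
(* [step_lin] preserves only the response, which other local states may also have; that [Done]
   itself persists is read off the event. *)
have Hd r q : c_loc c q = Done r -> c_loc c' q = Done r.
  move=> E1; have := Hlin q r; rewrite E1 => /(_ erefl).
  have := Hb q; rewrite E1.
  move: Ha; rewrite /apply_event; case: ifP => // _.
  case E2: (next_prim _ _) => [pr|] // ; case E3: (exec_prim _ _) => [c1 v].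
  move=> /Some_inj <- _ _ /=; case: eqP => [qp|_].
    by move: E2; rewrite -qp E1.
  by move: E3; rewrite -E1; case: (pr) => [|m|m|m w] /= [<- _].
case: Hq => [[Hn Hqq]|Hd'].
  exists S, id; split=> //; first exact: hist_Step.
    by rewrite Hqq labels_rcons //; case: HH.
  apply: (linked_Step p b HL Hb Ho Hd) => q Hi.
  case: (linked_busy HL Hi) => o [_ _ _].
  case E1: (lin c (c_loc c q)) => [r|]; first by rewrite (Hlin _ _ E1).
  case E2: (lin c' (c_loc c' q)) => [r|] //.
  have : q \in newly_lin n c c'.
    rewrite mem_filter E1 E2 mem_iota /= add0n ltnNge; apply/negP => nq.
    by move: Hi; rewrite (ok_idle Hok nq).
  by rewrite Hn.
set N := newly_lin n c c' in Hd'.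
pose cls := [seq (id q, odflt REmpty (lin c' (c_loc c' q))) | q <- N].
have HN q : q \in N -> [/\ ~~ is_idle (c_loc c q), lin c (c_loc c q) = None &
    exists r, lin c' (c_loc c' q) = Some r].
  rewrite mem_filter => /andP[/andP[H1 H2] _].
  case E1: (lin c _) H1 => // _; case E2: (lin c' _) H2 => [r|] // _.
  split=> //; last by exists r.
  by apply/negP => Hi; have := Hb q; rewrite Hi; case: (c_loc c' q) E2.
(* An invocation determines its process, so distinct busy processes have distinct ids. *)
have Uid : {in N &, injective id}.
  move=> q1 q2 /HN [H1 _ _] /HN [H2 _ _] Eid.
  case: (linked_busy HL H1) => o1 [I1 _ _ _].
  by case: (linked_busy HL H2) => o2 [I2 _ _ _]; move: I1; rewrite Eid I2 => -[].
have Ecls : [seq ir.1 | ir <- cls] = [seq id q | q <- N] by rewrite -map_comp.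
have HH' : hist E (rcons S cls).
  apply: hist_rcons => //.
    by rewrite Ecls map_inj_in_uniq // filter_uniq // iota_uniq.
  move=> ir /mapP[q qN ->] /=; case: (HN q qN) => Hi Hl _.
  by case: (linked_busy HL Hi) => o [-> -> _]; rewrite Hl.
exists (rcons S cls), id; split=> //; first exact: hist_Step.
  rewrite labels_rcons; last by case: HH'.
  rewrite /labels map_rcons; apply: ws_path_rcons HP _.
  suff -> : [seq (op_of E ir.1, ir.2) | ir <- cls] =
    [seq (op_of_loc (c_loc c q), odflt REmpty (lin c' (c_loc c' q))) | q <- N].
    exact: Hd'.
  rewrite -map_comp.
  apply/eq_in_map => q /HN [Hi Hl _] /=.
  case: (linked_busy HL Hi) => o [I _ O _].
  rewrite /op_of I; case: O => [[r Er]|-> //].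
  by rewrite Er in Hl.
apply: (linked_Step p b HL Hb Ho Hd) => q Hi.
case: (linked_busy HL Hi) => o [I _ _].
case E1: (lin c (c_loc c q)) => [r|].
  by rewrite (Hlin _ _ E1) flatten_rcons mem_cat => ->.
move=> Hn; case E2: (lin c' (c_loc c' q)) => [r|].
  have qN : q \in N.
    rewrite mem_filter E1 E2 mem_iota /= add0n ltnNge; apply/negP => nq.
    by move: Hi; rewrite (ok_idle Hok nq).
  rewrite flatten_rcons mem_cat; apply/orP; right.
  by apply/mapP; exists q => //; rewrite E2.
rewrite ids_rcons mem_cat negb_or Hn Ecls /=; apply/negP => /mapP[q' q'N Eq].
case: (HN q' q'N) => Hi' _ [r' E3].
case: (linked_busy HL Hi') => o' [I' _ _ _].
by move: I; rewrite Eq I' => -[Eqq _]; rewrite -Eqq E3 in E2.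
Qed.

Lemma simulates_Inv n E c p o c' :
  simulates n E c -> apply_event n c (Inv p o) = Some c' ->
  simulates n (rcons E (Inv p o)) c'.
Proof.
move=> [S [id [HH HP Hok HL]]] Ha.
(* Facts common to the three kinds of invocation: the queue and [lin] are unchanged, and the new
   operation is not linearized. *)
have [[Hok' Hq] [pn Hidle] [s' [Hs' Es' Hl'] [Lp Lq]] Hlin] :
  [/\ cfg_ok n c' /\ queue c' = queue c, p < n /\ c_loc c p = Idle,
      exists2 s', [/\ ~~ is_idle s', op_of_loc s' = o & lin c' s' = None]
      & c_loc c' p = s' /\ forall q, q != p -> c_loc c' q = c_loc c q
    & forall s, lin c' s = lin c s].
  move: Ha; rewrite /apply_event; case: ifP => // /andP[pn].
  case L: (c_loc c p) => // _.
  have Hnp t x wA wB : c_loc c p <> PutSt t x wA wB by rewrite L.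
  case: o => [x||].
  - case: ifP => // /andP[/eqP p0 x0] /Some_inj <-; subst p; split=> //.
      exact: cfg_ok_put.
    by eexists; last by split; [reflexivity|move=> q /negPf /= ->].
  - case: eqP => // p0 /Some_inj <-; subst p; split=> //.
      exact: cfg_ok_upd.
    by exists TakeInit => //; split=> // q /negPf /= ->.
  - case: eqP => // p0 /Some_inj <-; split=> //.
      exact: cfg_ok_upd.
    exists StealInit => //; split; first by rewrite /= eqxx.
    by move=> q /negPf /= ->.
exists S, (fun q => if q == p then size E else id q); split=> //.
- exact: hist_Inv.
- by rewrite Hq labels_rcons //; case: HH.
split.
- move=> q; case: (q =P p) => [->|/eqP qp].
    move=> _; exists o; rewrite complete_at_Inv inv_at_rcons eqxx Lp Hl'; split=> //.
    + by rewrite /complete_at /inv_at nth_default.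
    + by right.
    + by apply/negP => /(hist_inv HH)/inv_at_size; rewrite ltnn.
  rewrite Lq // => /(linked_busy HL) [o' [I C O L]]; exists o'.
  rewrite complete_at_Inv Hlin inv_at_rcons; split=> //.
  by case: eqP => // Eid; move: I; rewrite Eid /inv_at nth_default.
- move=> i q o'; rewrite complete_at_Inv inv_at_rcons; case: eqP => [->|_].
    by case=> <- _ _; rewrite eqxx Lp.
  move=> I C; case: (linked_pending HL I C) => Hi ->.
  case: (q =P p) => [qp|/eqP qp]; last by rewrite Lq.
  by move: Hi; rewrite qp Hidle.
Qed.

(** A responding process is in [Done r], whose [lin] is [Some r]; by [linked_busy] its operation is
    already in [S] with that response. *)
Lemma simulates_Resp n E c p r c' :
  simulates n E c -> apply_event n c (Resp p r) = Some c' ->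
  simulates n (rcons E (Resp p r)) c'.
Proof.
move=> [S [id [HH HP Hok HL]]]; rewrite /apply_event; case: ifP => // pn.
case Lp: (c_loc c p) => [||||||| r'] //; case: eqP => // Er /Some_inj <-.
subst r'.
have [Hok' Hq] : cfg_ok n (upd_loc c p Idle) /\ queue (upd_loc c p Idle) = queue c.
  by apply: cfg_ok_upd; rewrite ?Lp.
have Hi : ~~ is_idle (c_loc c p) by rewrite Lp.
exists S, id; split=> //.
- apply: hist_Resp HH => i o I C; case: (linked_pending HL I C) => _ ->.
  by case: (linked_busy HL Hi) => o' [_ _ _]; rewrite Lp.
- by rewrite Hq labels_rcons //; case: HH.
have Hinv i : inv_at (rcons E (Resp p r)) i = inv_at E i.
  by rewrite inv_at_rcons; case: eqP => // ->; rewrite /inv_at nth_default.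
split.
- move=> q /=; case: (q =P p) => // qp /(linked_busy HL) [o' [I C O L]].
  exists o'; rewrite Hinv complete_at_rcons C I; split=> //.
  by case: eqP => // pq; case: qp.
- move=> i q o; rewrite Hinv complete_at_rcons => I; rewrite I.
  case C: (complete_at E i) => //; case: (p =P q) => // pq _.
  case: (linked_pending HL I C) => Hq' ->; split=> //=.
  by case: eqP => // qp; case: pq.
Qed.

Lemma simulates_run n init E c :
  init 1 = BOT -> init 2 = BOT ->
  run n (init_cfg init) E = Some c -> simulates n E c.
Proof.
move=> i1 i2; elim/last_ind: E c => [c [<-]|E e IH c]; first exact: simulates_init.
rewrite run_rcons; case Er: (run _ _ E) => [c1|] //= Ha.
case: e Ha => [p o|p b|p r] Ha.
- exact: simulates_Inv (IH _ Er) Ha.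
- exact: simulates_Step (IH _ Er) Ha.
- exact: simulates_Resp (IH _ Er) Ha.
Qed.

Lemma simulates_set_linearizable n E c :
  simulates n E c -> set_linearizable n E.
Proof.
move=> [S [id [[H1 H2 H3 H4] HP _ _]]]; exists S.
have Hin (cl : seq (nat * resp)) ir : List.In cl S -> List.In ir cl -> ir \in flatten S.
  by move=> /In_mem clS /In_mem ircl; apply/flattenP; exists cl.
split; first by move=> cl ir clS ircl; apply: H1; apply: map_f; apply: Hin clS ircl.
split=> //; split.
  move=> i k r /H3 /flattenP[cl clS icl]; exists cl.
  by split; apply/In_mem.
split; first exact: ws_path_run HP.
by move=> k1 k2 i j r1 r2 /In_mem I1 /In_mem I2; apply: H4 I1 I2.
Qed.

(** * Step complexity and progress *)

Definition steps_left (s : lstate) : nat :=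
  match s with
  | PutSt _ _ wA wB => ~~ wA + ~~ wB
  | TakeInit | StealInit => 3
  | TakeSt _ rx mw => ~~ isSome rx + ~~ mw
  | StealTask _ => 2
  | StealWrite _ _ => 1
  | _ => 0
  end.

(** [steps_left] is a potential: each step of [p] strictly decreases it, and events of other
    processes do not affect it. *)
Lemma steps_bound n c E c' p :
  run n c E = Some c' -> ~~ is_idle (c_loc c p) ->
  count (is_step_of p) (before_resp p E) <= steps_left (c_loc c p).
Proof.
elim: E c => [|e E IH] c; first by case: (c_loc c p).
rewrite run_cons; case Ha: (apply_event n c e) => [c1|] //= Hr Hi.
case: e Ha => [q o|q b|q r] /=.
- case: ifP => // /andP[_ Hq] Ho; rewrite add0n.
  have qp : p != q by apply/eqP => pq; rewrite pq Hq in Hi.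
  have <- : c_loc c1 p = c_loc c p; last apply: IH => //.
    by case: o Ho => [x||]; case: ifP => // _ /Some_inj <- /=; rewrite (negPf qp).
  by case: o Ho => [x||]; case: ifP => // _ /Some_inj <- /=; rewrite (negPf qp).
- case: ifP => // _; case Ep: (next_prim _ b) => [pr|] //.
  case Ex: (exec_prim c pr) => [c2 v] /Some_inj E1.
  have L2 : c_loc c2 = c_loc c by case: pr Ex {Ep} => [|m|m|m w] /= [<- _].
  have := IH _ Hr; rewrite -E1 /= L2.
  case: (p =P q) => [->|/eqP pq]; last by rewrite eq_sym (negPf pq) add0n; apply.
  rewrite eqxx add1n => Hc.
  suff /andP[H1 H2] : ~~ is_idle (after (c_loc c q) b v (c_tail c)) &&
     (steps_left (after (c_loc c q) b v (c_tail c)) < steps_left (c_loc c q)).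
    by apply: leq_ltn_trans H2; apply: Hc.
  case: (c_loc c q) Ep => [|t x [] []||h [x|] []||h|h x|r] //= _; first by case: (b).
  + by case: ifP.
  + by case: (b).
  + by case: ifP.
- case: ifP => // _; case L: (c_loc c q) => [||||||| r'] //.
  case: eqP => // _ /Some_inj E1.
  case: (q =P p) => // /eqP qp; rewrite ?add0n.
  have := IH _ Hr; rewrite -E1 /= eq_sym (negPf qp); exact.
Qed.

Lemma op_steps_le n c E c' i : run n c E = Some c' -> op_steps E i <= 3.
Proof.
move=> Hr; rewrite /op_steps; case I: (inv_at E i) => [[p o]|] //.
have Hi : i < size E by apply: inv_at_size; rewrite I.
move: Hr; rewrite -{1}(cat_take_drop i E) run_cat.
case: (run n c _) => [c1|] //=; rewrite (drop_nth (Step 0 false) Hi).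
have -> : nth (Step 0 false) E i = Inv p o.
  by move: I; rewrite /inv_at; case: nth => // q o' [-> ->].
rewrite run_cons; case Ha: (apply_event _ _ _) => [c2|] //= Hr.
have [Hb Hs] : ~~ is_idle (c_loc c2 p) /\ steps_left (c_loc c2 p) <= 3.
  move: Ha => /=; case: ifP => // _.
  by case: o {I} => [x||]; case: ifP => // _ /Some_inj <- /=; rewrite eqxx.
exact: leq_trans (steps_bound Hr Hb) Hs.
Qed.

(** Apart from [Idle] and [Done], only states with both flags of a braced pair set have no next
    instruction, and [loc_ok] excludes them. *)
Lemma next_prim_enabled n c p b :
  cfg_ok n c -> c_loc c p <> Idle ->
  (exists r, c_loc c p = Done r) \/ next_prim (c_loc c p) b <> None.
Proof.
move=> Hok; have := ok_loc Hok p.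
case: (c_loc c p) => [|t x [] []||h [x|] []||h|h x|r] //=; try by right.
- by case.
- by case=> _ _ _ _ [].
- by left; exists r.
Qed.

Theorem theorem1 :
  exists K : nat,
  forall (n : nat) (init : nat -> nat),
    2 <= n -> init 1 = BOT -> init 2 = BOT ->
    (* set-linearizability of every finite execution (for every ordering of
       the braced instructions, i.e. fence-free) *)
    (forall E c, run n (init_cfg init) E = Some c -> set_linearizable n E)
    (* wait-freedom with step complexity bounded by the constant K:
       (a) a process with a pending, unfinished operation can always step,
       (b) every operation takes at most K of its own steps *)
    /\ (forall c p, reachable n init c -> p < n -> c_loc c p <> Idle ->
          (exists r, c_loc c p = Done r) \/
          (forall b, apply_event n c (Step p b) <> None))
    /\ (forall E c i, run n (init_cfg init) E = Some c -> op_steps E i <= K)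
    (* Put uses only Read/Write instructions *)
    /\ (forall c t x wA wB b pr, reachable n init c ->
          c_loc c 0 = PutSt t x wA wB -> next_prim (PutSt t x wA wB) b = Some pr ->
          is_rw pr).
Proof.
(* Take and Steal use at most one [PMaxRead], one [PRead] and one [PMaxWrite]; Put uses two
   writes. *)
exists 3 => n init _ i1 i2; split; last split; last split.
- by move=> E c /(simulates_run i1 i2)/simulates_set_linearizable.
- move=> c p [E /(simulates_run i1 i2) [S [id [_ _ Hok _]]]] pn Hi.
  (* Being in [Done] does not depend on the choice [b], so treating both values yields the
     disjunction uniformly in [b]. *)
  have [Hd|Ht] := next_prim_enabled true Hok Hi; first by left.
  have [Hd|Hf] := next_prim_enabled false Hok Hi; first by left.
  right=> b; rewrite /apply_event pn.
  have : next_prim (c_loc c p) b <> None by case: b.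
  by case: (next_prim _ b) => // pr _; case: (exec_prim c pr).
- by move=> E c i; apply: op_steps_le.
- by move=> c t x [] [] b pr _ _ //= [<-] //; case: b.
Qed.
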